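(* Let $X$ and $Z$ be Hausdorff, locally convex topological vector spaces, let $C\subseteq Z$ be a convex, pointed cone, and let $K$ be a nonempty, convex and compact subset of $X$. Let $D\subseteq K$ be a self segment-dense set in $K$ and consider a mapping $f:K\times K\to Z$ satisfying (i) for all $y\in D$, the mapping $x\mapsto f(x,y)$ is strongly $C$-upper semicontinuous on $K$; (ii) for all $x\in K$, the mapping $y\mapsto f(x,y)$ is strongly $C$-upper semicontinuous on $K\setminus D$; (iii) for all $x\in D$, the mapping $y\mapsto f(x,y)$ is $C$-convex on $D$; (iv) for all $x\in D$, $f(x,x)\notin -C\setminus\{0\}$. Then there exists $x_0\in K$ such that $f(x_0,y)\notin -C\setminus\{0\}$ for all $y\in K$.
   Context: All vector spaces are real. $\operatorname{cl}$ denotes closure. $-C\setminus\{0\}$ denotes $(-C)\setminus\{0\}=-(C\setminus\{0\})$. The interior of $C$ is allowed to be empty. A set $C\subseteq Z$ is a cone if $tc\in C$ for all $c\in C$ and $t\ge 0$; it is convex if $C+C=C$, and pointed if $C\cap(-C)=\{0\}$. Write $z_1\le z_2$ iff $z_2-z_1\in C$. Strong $C$-upper semicontinuity: a map $g:K\to Z$ is strongly $C$-upper semicontinuous at $x\in K$ if for any $k\in C\setminus\{0\}$ there exists a neighborhood $U$ of $x$ such that $g(u)\in g(x)+k-(C\setminus\{0\})$ for all $u\in U\cap K$. It is strongly $C$-upper semicontinuous on a subset $S\subseteq K$ if it is so, as a map on $K$, at every point of $S$. $C$-convexity: for a (not necessarily convex) set $D$, $g$ is $C$-convex on $D$ if for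 all $n\in\mathbb N$, $x_1,\dots,x_n\in D$ and $\lambda_1,\dots,\lambda_n\ge 0$ with $\sum_{i=1}^n\lambda_i=1$ such that $\sum_{i=1}^n\lambda_i x_i\in D$, one has $g\left(\sum_{i=1}^n\lambda_i x_i\right)\le\sum_{i=1}^n\lambda_i g(x_i)$. Self segment-dense set: let $U\subseteq V\subseteq X$ with $V$ convex. $U$ is self segment-dense in $V$ if $U$ is dense in $V$ (i.e. $V\subseteq\operatorname{cl}U$) and for all $x,y\in U$ the set $[x,y]\cap U$ is dense in $[x,y]$, where $[x,y]=\{x+t(y-x):t\in[0,1]\}$. *)

(* Defs.v *)
From HB Require Import structures.
From mathcomp Require Import all_boot all_order all_algebra.
From mathcomp Require Import all_classical all_reals all_analysis.

Set Implicit Arguments.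
Unset Strict Implicit.
Unset Printing Implicit Defensive.

Import Order.TTheory GRing.Theory Num.Theory.
Import numFieldNormedType.Exports.

Local Open Scope classical_set_scope.
Local Open Scope ring_scope.

Section Cones.
Context {R : realType} {Z : lmodType R}.
Implicit Types (C : set Z) (z : Z).

Definition is_cone C := forall c t, C c -> 0 <= t -> C (t *: c).

(* For a cone C this amounts to [convex_set C] when C is nonempty. *)
Definition convex_cone C := is_cone C /\ [set a + b | a in C & b in C] = C.

Definition pointed_cone C := C `&` [set - c | c in C] = [set 0].

Definition cone_le C z1 z2 := C (z2 - z1).

End Cones.

(* Maps defined on a subset K of X are represented by total maps X -> Z of
   which only the values on K are used. *)
Section VectorMaps.
Context {R : realType} {X : tvsType R} {Z : lmodType R}.
Implicit Types (C : set Z) (K S D : set X) (g : X -> Z).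

Definition strongly_usc_at C K g (x : X) :=
  forall k, (C `\ 0) k ->
    \forall u \near x, K u -> [set g x + k - c | c in C `\ 0] (g u).

Definition strongly_usc_on C K S g :=
  forall x, S x -> strongly_usc_at C K g x.

(* D need not be convex: only convex combinations that fall in D count. *)
Definition C_convex_on C D g :=
  forall (n : nat) (x : 'I_n -> X) (lambda : 'I_n -> R),
    (forall i, D (x i)) -> (forall i, 0 <= lambda i) ->
    \sum_(i < n) lambda i = 1 ->
    D (\sum_(i < n) lambda i *: x i) ->
    cone_le C (g (\sum_(i < n) lambda i *: x i))
              (\sum_(i < n) lambda i *: g (x i)).

End VectorMaps.

Section SegmentDensity.
Context {R : realType} {X : tvsType R}.
Implicit Types (U V : set X) (x y : X).

Definition segment x y : set X := [set x + t *: (y - x) | t in `[0 : R, 1]].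

Definition dense_in U V := V `<=` closure U.

Definition self_segment_dense U V :=
  dense_in U V /\
  forall x y, U x -> U y -> dense_in (segment x y `&` U) (segment x y).

End SegmentDensity.

(* Main.v *)
Require Import Defs.
From mathcomp Require Import all_boot zify.

(* For y in D let G y be the set of x in K with f x y not in -C \ {0}; by (i) it
   is relatively closed.  A point of all the G y, y in D, is the required x0: by
   (ii) and density of D the property extends from D to K.  If there is no such
   point, compactness gives y_1, ..., y_n in D whose G y_i have empty
   intersection, and the KKM principle for open sets gives a combination
   p = sum l_i y_i with p outside G y_i whenever l_i > 0.  This is an open
   condition on p, and self segment-density moves p to a d in D which is a
   combination of the same y_i; C-convexity of f d then contradicts (iv) at d.
   The KKM principle is derived from Scarf's lemma on families of linear
   orders, applied to the coordinate orders of a fine grid of the simplex. *)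

Set Implicit Arguments.
Unset Strict Implicit.
Unset Printing Implicit Defensive.

(** * Scarf's lemma *)

Section Dominance.
Variables (V I : finType) (r : I -> V -> nat).
Hypothesis r_inj : forall i, injective (r i).

(** For nonempty [S], this says that no [y] exceeds the minimum of [S] in all the orders at once. *)
Definition dominant (S : {set V}) :=
  [forall y, exists i, forall s in S, r i y <= r i s].

Lemma dominantP (S : {set V}) :
  reflect (forall y, exists i, forall s, s \in S -> r i y <= r i s)
          (dominant S).
Proof.
apply: (iffP forallP) => domS y.
  by have /existsP[i /forall_inP ?] := domS y; exists i.
by have [i ?] := domS y; apply/existsP; exists i; apply/forall_inP.
Qed.

Lemma dominant_sub (S S' : {set V}) :
  S \subset S' -> dominant S' -> dominant S.
Proof.
move=> /subsetP sSS' /dominantP domS'; apply/dominantP => y.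
by have [i rS'] := domS' y; exists i => s /sSS'; apply: rS'.
Qed.

(* As |S| = |I| - 1, exactly two indices a, b have the same minimizer in S.  The
   admissible x are, for k = a and k = b, the r k-largest element among those
   that exceed min S for all the orders r l with l != k. *)
Lemma dominant_door_card2 (S : {set V}) (s0 : V) : s0 \in S ->
    #|S|.+1 = #|I| -> dominant S ->
    (forall k, exists x, forall l, l != k -> exists2 s, s \in S & r l s < r l x) ->
  #|[set x | (x \notin S) && dominant (x |: S)]| = 2.
Proof.
move=> Ss0 cardS /dominantP domS room_ex.
pose m i := [arg min_(s < s0 in S) r i s].
have mS i : m i \in S by rewrite /m; case: arg_minnP.
have m_min i s : s \in S -> r i (m i) <= r i s.
  by rewrite /m; case: arg_minnP => // t _; apply.
(* Dominance tested at [s] itself: some order attains its minimum over [S] at [s]. *)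
have m_onto s : s \in S -> exists2 i, r i s <= r i (m i) & m i = s.
  move=> Ss; have [i ri] := domS s; exists i; first exact: ri.
  by apply: (@r_inj i); apply/eqP; rewrite eqn_leq m_min // ri.
have card_setC1 (k : I) : #|[set~ k]| = #|S|.
  by rewrite cardsC1 -cardS.
have [a [b [neq_ab m_ab]]] : exists a b, a != b /\ m a = m b.
  have /injectivePn[a [b neq_ab m_ab]] : ~~ injectiveb m.
    apply/negP => /injectiveP m_inj.
    have sub : [set m i | i in I] \subset S.
      by apply/subsetP => _ /imsetP[i _ ->].
    by have := subset_leq_card sub; rewrite card_imset // -cardS ltnn.
  by exists a, b; split=> //; rewrite eq_sym.
have m_inj k : S \subset [set m i | i in [set~ k]] ->
    {in [set~ k] &, injective m}.
  move=> sS; apply/imset_injP.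
  by rewrite eqn_leq leq_imset_card card_setC1 subset_leq_card.
have m_ontoC k : k \in [set a; b] -> S \subset [set m i | i in [set~ k]].
  rewrite !inE => /orP k_ab; apply/subsetP => s /m_onto[i _ <-].
  have [->|neq_ik] := eqVneq i k; last by apply: imset_f; rewrite !inE.
  case: k_ab => /eqP->; first by rewrite m_ab imset_f // !inE eq_sym.
  by rewrite -m_ab imset_f // !inE.
pose U k y := [forall l, (l != k) ==> (r l (m l) < r l y)].
have UP k y : reflect (forall l, l != k -> r l (m l) < r l y) (U k y).
  by apply: (iffP forall_inP).
have roomP x : (x \notin S) && dominant (x |: S) =
    [exists k in [set a; b], U k x && [forall y, U k y ==> (r k y <= r k x)]].
  apply/andP/existsP => [[xS /dominantP domSx] | [k /and3P[kab /UP Ukx /forall_inP kmax]]].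
    (* [P] collects the orders whose minimum over [S] survives the addition of [x]. It misses [k],
       yet [m] maps it onto [S], so by cardinality it is [[set~ k]]. *)
    pose P := [set i | r i (m i) <= r i x].
    have [k rk] := domSx x.
    have kP : k \notin P.
      rewrite inE -ltnNge ltn_neqAle rk ?setU1r ?mS // andbT.
      by apply/eqP => /r_inj xm; rewrite xm mS in xS.
    have sSP : S \subset [set m i | i in P].
      apply/subsetP => s Ss; have [i ri] := domSx s.
      have mi : m i = s.
        by apply: (@r_inj i); apply/eqP; rewrite eqn_leq m_min // ri ?setU1r ?mS.
      by rewrite -mi imset_f // inE mi ri // setU11.
    have sPk : P \subset [set~ k].
      by apply/subsetP => i iP; rewrite !inE; apply: contraNneq kP => <-.
    have Pk : P = [set~ k].
      apply/eqP; rewrite eqEcard sPk card_setC1.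
      exact: leq_trans (subset_leq_card sSP) (leq_imset_card _ _).
    have Ukx l : l != k -> r l (m l) < r l x.
      move=> lk; have : l \in P by rewrite Pk !inE.
      rewrite inE ltn_neqAle => ->; rewrite andbT.
      by apply/eqP => /r_inj ml; rewrite -ml mS in xS.
    exists k; apply/and3P; split.
    - rewrite -[_ \in _]negbK; apply/negP; rewrite !inE negb_or => /andP[ka kb].
      move: neq_ab; rewrite (m_inj k _ a b _ _ m_ab) ?eqxx //.
      + by rewrite -Pk.
      + by rewrite !inE eq_sym.
      + by rewrite !inE eq_sym.
    - exact/UP.
    apply/forall_inP => y /UP Uky; have [i ri] := domSx y.
    have [ik|/Uky] := eqVneq i k; first by rewrite -ik ri // setU11.
    by rewrite ltnNge ri // setU1r ?mS.
  split.
    apply/negP => /(subsetP (m_ontoC _ kab)) /imsetP[i].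
    by rewrite !inE => /Ukx + xm; rewrite -xm ltnn.
  apply/dominantP => y; have [/UP Uky|] := boolP (U k y).
    have [i ri] := domS y.
    have ik : i = k.
      by apply/eqP; apply/negPn/negP => /Uky; rewrite ltnNge ri ?mS.
    exists k => s; rewrite !inE => /orP[/eqP->|]; first by apply: kmax; apply/UP.
    by rewrite -ik; apply: ri.
  case/forall_inPn => l lk; rewrite -leqNgt => rl; exists l => s.
  rewrite !inE => /orP[/eqP->|Ss]; last exact: leq_trans rl (m_min _ _ Ss).
  exact: leq_trans rl (ltnW (Ukx _ lk)).
have top k : exists2 x, U k x & forall y, U k y -> r k y <= r k x.
  have [x0 Ux0] : exists x0, U k x0.
    have [x0 rx0] := room_ex k; exists x0; apply/UP => l /rx0[s Ss].
    exact: leq_ltn_trans (m_min _ _ Ss).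
  by exists [arg max_(y > x0 | U k y) r k y]; case: arg_maxnP.
have [xa Ua xa_max] := top a; have [xb Ub xb_max] := top b.
(* A common value would exceed the minimum of [S] in every order, against dominance. *)
have neq_x : xa != xb.
  apply/eqP => xab; have [i ri] := domS xa.
  have [ia|ia] := eqVneq i a.
    move/UP: Ub => /(_ i); rewrite ia neq_ab => /(_ isT).
    by rewrite ltnNge -xab -ia ri ?mS.
  by move/UP: Ua => /(_ i ia); rewrite ltnNge ri ?mS.
rewrite (_ : [set _ | _] = [set xa; xb]) ?cards2 ?neq_x //.
apply/setP => x; rewrite inE roomP !inE; apply/existsP/orP.
  case=> k /and3P[+ Ux /forall_inP x_max].
  rewrite !inE => /orP[]/eqP kE; rewrite kE in Ux x_max; [left|right];
  by apply/eqP/(@r_inj k)/eqP; rewrite eqn_leq kE ?xa_max ?xb_max ?x_max.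
case=> /eqP->; [exists a|exists b]; rewrite !inE eqxx ?orbT /=.
  by rewrite Ua; apply/forall_inP.
by rewrite Ub; apply/forall_inP.
Qed.

End Dominance.

Section Scarf.
Variables (T I : finType) (r : I -> T -> nat) (c : T -> I).
Hypothesis r_inj : forall i, injective (r i).

(* Element [inr i] is the least one for the order i, and above all of T for the
   other orders.  A set S of T + I encodes the pair formed by the set of t with
   [inl t] in S and the set of i with [inr i] not in S; this makes all doors
   obtainable by removing one element from a room. *)
Definition slack_rank (i : I) (v : T + I) : nat :=
  match v with
  | inl t => (r i t).+1
  | inr j => if j == i then 0 else (\max_t r i t).+2 + enum_rank j
  end.

Definition slack_color (v : T + I) : I :=
  match v with inl t => c t | inr i => i end.

Lemma slack_rank_lt i j t : j != i -> slack_rank i (inl t) < slack_rank i (inr j).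
Proof.
by move=> /negPf /= ->; rewrite !ltnS (leq_trans _ (leq_addr _ _)) ?ltnS ?leq_bigmax.
Qed.

Lemma slack_rank_inj i : injective (slack_rank i).
Proof.
have lt_neq t j : slack_rank i (inl t) <> slack_rank i (inr j).
  have [->|ji /eqP] := eqVneq j i; first by rewrite /= eqxx.
  by rewrite ltn_eqF // slack_rank_lt.
move=> [t|j] [t'|j'] /=.
- by case=> /r_inj ->.
- by move/(lt_neq t j').
- by move/esym/(lt_neq t' j).
- have [->|_] := eqVneq j i; have [->|_] := eqVneq j' i => //.
  by move/addnI/ord_inj/enum_rank_inj ->.
Qed.

Local Notation dom := (dominant slack_rank).
Let slack_door (i0 : I) : {set T + I} := [set inr i | i in [set~ i0]].

(** This is the outer door. For [i != i0] the order [i] cannot witness dominance at [inl tm], since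
    the door contains [inr i], of rank 0. So the order [i0] does, which forces [x] to be its largest
    element in [T]. *)
Lemma slack_door_card1 (t0 : T) (i0 : I) :
  #|[set x | (x \notin slack_door i0) && dom (x |: slack_door i0)]| = 1.
Proof.
pose tm := [arg max_(t > t0) r i0 t].
have tm_max t : r i0 t <= r i0 tm by rewrite /tm; case: arg_maxnP => // ? _; apply.
have inl_door t : inl t \notin slack_door i0 by apply/imsetP => -[].
have inr_door i : (inr i \in slack_door i0) = (i != i0).
  by rewrite /slack_door mem_imset ?inE // => ? ? [].
rewrite (_ : [set _ | _] = [set inl tm]) ?cards1 //; apply/setP => x; rewrite !inE.
apply/andP/eqP => [[xS /dominantP domx]|->].
  have [i ri] := domx (inl tm).
  have ii0 : i = i0.
    apply/eqP; apply: contraT; rewrite -inr_door => iS.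
    by have := ri _ (setU1r x iS); rewrite /= eqxx.
  rewrite {}ii0 {i} in ri; have := ri x (setU11 _ _).
  case: x xS {domx ri} => [t _|i]; last first.
    by rewrite inr_door negbK => /eqP->; rewrite /= eqxx.
  by rewrite ltnS => rt; congr inl; apply/(@r_inj i0)/eqP; rewrite eqn_leq tm_max.
split; first exact: inl_door.
apply/dominantP => -[t|i].
  exists i0 => s; rewrite !inE => /orP[/eqP->|]; first by rewrite ltnS.
  by case/imsetP=> j; rewrite !inE => j_i0 ->; apply/ltnW/slack_rank_lt.
by exists i => s _; rewrite /= eqxx.
Qed.

Lemma odd_sum_one_odd (A : finType) (P : pred A) (a0 : A) (F : A -> nat) :
  P a0 -> odd (F a0) -> (forall a, P a -> a != a0 -> ~~ odd (F a)) ->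
  odd (\sum_(a | P a) F a).
Proof.
move=> Pa0 oddF evenF; rewrite (bigD1 a0) //= oddD oddF.
by elim/big_ind: _ => // [m n|a /andP[Pa]]; [rewrite oddD => /negPf->|apply: evenF].
Qed.

(** The two conditions make the colours on [S] pairwise distinct. Dominance is inherited from any
    dominant [x |: S]. *)
Definition door (i0 : I) (S : {set T + I}) :=
  (#|S|.+1 == #|I|) && ([set slack_color x | x in S] == [set~ i0]).

Lemma odd_rooms_over_doors (t0 : T) (i0 : I) :
  odd (\sum_(S | door i0 S) #|[set x | (x \notin S) && dom (x |: S)]|).
Proof.
have inr_inj : injective (@inr T I) by move=> ? ? [].
apply: (@odd_sum_one_odd _ _ (slack_door i0)).
- rewrite /door card_imset // cardsC1 prednK ?eqxx; last by apply/card_gt0P; exists i0.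
  by rewrite -imset_comp (eq_imset _ (_ : _ =1 id)) ?imset_id ?eqxx.
- by rewrite slack_door_card1.
move=> S /andP[/eqP cardS /eqP colS] S_slack.
(* On slack elements alone, the colours would put [S] inside the outer door, and cardinality would
   make them equal. *)
have [s0 Ss0] : exists t, inl t \in S.
  apply/existsP; apply: contraNT S_slack; rewrite negb_exists => /forallP inlS.
  rewrite eqEcard; apply/andP; split.
    apply/subsetP => -[t|i] xS; first by rewrite (negPf (inlS t)) in xS.
    by rewrite mem_imset // -colS; apply/imsetP; exists (inr i).
  by rewrite card_imset // cardsC1 -cardS.
have [->|[x]] := set_0Vmem [set x | (x \notin S) && dom (x |: S)]; first by rewrite cards0.
rewrite inE => /andP[_ domxS].
rewrite (@dominant_door_card2 _ _ _ slack_rank_inj S (inl s0)) //.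
  exact: dominant_sub (subsetUr _ _) domxS.
by move=> k; exists (inr k) => l lk; exists (inl s0); rewrite // slack_rank_lt // eq_sym.
Qed.

(** If removing [x] leaves exactly the colours other than [i0], these are then pairwise distinct,
    and [x] repeats the colour of a single [x']. Removing [x'] works too, and nothing else does. *)
Lemma even_doors_of_room (i0 : I) (S : {set T + I}) :
    #|S| = #|I| -> [set slack_color x | x in S] != setT ->
  ~~ odd #|[set x in S | [set slack_color y | y in S :\ x] == [set~ i0]]|.
Proof.
move=> cardS colS.
set A := [set x in S | _]; have [->|[x]] := set_0Vmem A; first by rewrite cards0.
rewrite inE => /andP[Sx /eqP colSx].
have cardSx : #|S :\ x|.+1 = #|I| by rewrite -cardS (cardsD1 x S) Sx.
have col_inj : {in S :\ x &, injective slack_color}.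
  by apply/imset_injP; rewrite colSx cardsC1 -cardSx.
have colx : slack_color x != i0.
  apply: contraNneq colS => colx; rewrite -(setD1K Sx) imsetU1 colSx colx.
  by apply/eqP/setP => i; rewrite !inE orbN.
have : slack_color x \in [set~ i0] by rewrite !inE.
rewrite -colSx => /imsetP[x' Sx' col_xx'].
have /andP[neq_x Sx'S] : (x' != x) && (x' \in S) by move: Sx'; rewrite !inE.
rewrite (_ : A = [set x; x']) ?cards2 1?eq_sym ?neq_x //.
apply/setP => z; rewrite inE [RHS]inE !in_set1.
have [->|zx] /= := eqVneq z x; first by rewrite Sx colSx eqxx.
have [->|zx'] /= := eqVneq z x'.
  rewrite Sx'S -colSx eqEsubset /=; apply/andP; split; apply/subsetP => _ /imsetP[y + ->].
    rewrite !inE => /andP[yx' Sy]; have [->|yx] := eqVneq y x.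
      by rewrite col_xx' imset_f.
    by rewrite imset_f // !inE yx.
  rewrite !inE => /andP[yx Sy]; have [->|yx'] := eqVneq y x'.
    by rewrite -col_xx' imset_f // !inE eq_sym neq_x.
  by rewrite imset_f // !inE yx'.
apply/negbTE; apply/negP => /andP[Sz /eqP colSz].
have Szx : z \in S :\ x by rewrite !inE zx.
have : slack_color z \in [set~ i0] by rewrite -colSx imset_f.
rewrite -colSz => /imsetP[y]; rewrite !inE => /andP[yz Sy] col_zy.
have [yx|yx] := eqVneq y x.
  by move: zx'; rewrite (col_inj z x') ?eqxx // -col_xx' -yx.
by move: yz; rewrite (col_inj z y) ?eqxx // !inE yx.
Qed.

(* Double counting of the pairs (room, door of color [set~ i0] in it): without a
   room of all colors, every room has an even number of such doors, whereas all
   such doors but the outer one lie in an even number of rooms. *)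
Lemma colorful_room (t0 : T) : exists S : {set T + I},
  dom S /\ [set slack_color x | x in S] = setT.
Proof.
pose i0 := c t0; pose col (S : {set T + I}) := [set slack_color x | x in S].
have [/existsP[S /andP[domS /eqP colS]]|noS] :=
  boolP [exists S, dom S && (col S == setT)]; first by exists S.
have := odd_rooms_over_doors t0 i0.
under eq_bigr do rewrite -sum1_card; rewrite pair_big_dep /=.
(* Pairs of a door and an element completing it are recounted as pairs of a room and an element
   removed from it. *)
rewrite (reindex_onto (fun p : {set T + I} * (T + I) => (p.1 :\ p.2, p.2))
                      (fun p => (p.2 |: p.1, p.2))) /=; last first.
  by case=> S x /=; rewrite inE => /andP[_ /andP[xS _]]; rewrite setU1K.
rewrite (eq_bigl (fun p : {set T + I} * (T + I) =>
    (dom p.1 && (#|p.1| == #|I|)) && (p.2 \in [set x in p.1 | col (p.1 :\ x) == [set~ i0]]))).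
  rewrite -(pair_big_dep (fun S => dom S && (#|S| == #|I|))
    (fun S x => x \in [set x in S | col (S :\ x) == [set~ i0]]) (fun _ _ => 1)) /=.
  under eq_bigr do rewrite sum1_card.
  elim/big_ind: _ => // [m n|S /andP[domS /eqP cardS]].
    by rewrite oddD => odd_m odd_n; case: (odd m) odd_m => [/(_ isT)|].
  move=> oddS; have := even_doors_of_room i0 cardS.
  case: eqP => [colS _|_ /(_ isT)]; last by rewrite oddS.
  by case/existsP: noS; exists S; rewrite domS; apply/eqP.
case=> S x /=; rewrite !inE eqxx /= /door xpair_eqE eqxx andbT.
have [Sx|Sx] := boolP (x \in S).
  rewrite setD1K // eqxx andbT (cardsD1 x S) Sx add1n.
  by rewrite andbC; case: (dom S); rewrite //= andbF.
rewrite /= andbF; apply/negbTE; rewrite negb_and; apply/orP; right.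
by apply: contraNneq Sx => <-; rewrite setU11.
Qed.

Lemma scarf (t0 : T) : exists s : {set T}, forall y, exists2 i,
  i \in [set c x | x in s] & forall x, x \in s -> r i y <= r i x.
Proof.
have [S [/dominantP domS colS]] := colorful_room t0.
exists [set t | inl t \in S] => y; have [i ri] := domS (inl y); exists i; last first.
  by move=> x; rewrite inE => /ri.
have : i \in [set slack_color x | x in S] by rewrite colS inE.
case/imsetP=> -[t St ->|j Sj /= ij]; first by rewrite /= imset_f ?inE.
(* The colour [i] cannot come from a slack element: [inr i] has rank 0 in the order [i], strictly
   below [inl y]. *)
by have := ri _ Sj; rewrite /= ij eqxx.
Qed.

End Scarf.

(** * Coloured grids of the simplex *)

Section Grid.
Variables (I : finType) (N : nat).

Definition grid_simplex := {x : {ffun I -> 'I_N.+1} | \sum_i x i == N}.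

Lemma grid_simplex_ex (w : I -> nat) : \sum_i w i = N ->
  exists x : grid_simplex, forall i, w i = val x i.
Proof.
move=> sumw; have wN i : w i < N.+1 by rewrite ltnS -sumw (bigD1 i) //= leq_addr.
pose x := [ffun i => Ordinal (wN i)].
have xN : \sum_i x i == N by apply/eqP/(etrans _ sumw); apply: eq_bigr => i _; rewrite ffunE.
by exists (exist _ x xN) => i; rewrite /= ffunE.
Qed.

(* Compares i-th coordinates, with ties broken by enumeration rank. *)
Definition grid_rank (i : I) (x : grid_simplex) : nat :=
  val x i * #|{: grid_simplex}| + enum_rank x.

Lemma grid_rank_inj i : injective (grid_rank i).
Proof.
move=> x y rxy; apply/enum_rank_inj/ord_inj.
have := congr1 (modn^~ #|{: grid_simplex}|) rxy.
by rewrite /grid_rank !modnMDl !modn_small.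
Qed.

Lemma grid_rank_le i x y : grid_rank i x <= grid_rank i y -> val x i <= val y i.
Proof.
rewrite /grid_rank => rxy; rewrite leqNgt; apply/negP => yx; move: rxy; apply/negP.
rewrite -ltnNge (@leq_trans ((val y i).+1 * #|{: grid_simplex}|)) //.
  by rewrite mulSn addnC ltn_add2r.
by rewrite (leq_trans _ (leq_addr _ _)) // leq_mul2r yx orbT.
Qed.

(** Scarf's lemma yields a set [s] of grid points showing every colour [i] with [z i] positive. All
    points of [s] lie near [z], as the minima of their coordinates already sum almost to [N]. *)
Lemma colored_grid (c : (I -> nat) -> I) (i0 : I) :
  exists2 z : I -> nat, \sum_i z i = N &
    forall i, 0 < z i -> exists2 x : I -> nat, \sum_i x i = N &
      c x = i /\ forall j, z j <= x j + #|I| /\ x j <= z j + #|I|.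
Proof.
have [t0 _] : exists t : grid_simplex, forall i, (if i == i0 then N else 0) = val t i.
  by apply: grid_simplex_ex; rewrite -big_mkcond big_pred1_eq.
pose cg (x : grid_simplex) := c (fun i => val x i).
have [s dom_s] := scarf cg grid_rank_inj t0.
set C := [set cg x | x in s] in dom_s.
have [i1 Ci1 _] := dom_s t0; have /imsetP[x0 sx0 _] := Ci1.
(* The minima m of the coordinates in C over the dominant set s have a sum within
   #|C| of N, else some grid point would exceed them all; topping them up at one
   coordinate yields z. *)
pose m i : nat := val [arg min_(x < x0 in s) (val x i : nat)] i.
have m_min i x : x \in s -> m i <= val x i.
  by rewrite /m; case: arg_minnP => // y _ + sx; apply.
have m_val i : exists2 x, x \in s & m i = val x i.
  by rewrite /m; case: arg_minnP => // y sy _; exists y.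
have sum_val (x : grid_simplex) : \sum_i val x i = N by apply/eqP/(valP x).
have sum_ge j x : x \in s -> val x j + \sum_(i in C | i != j) m i <= N.
  move=> sx; rewrite -[X in _ <= X](sum_val x) [X in _ <= X](bigD1 j) //= leq_add2l.
  rewrite [X in _ <= X](bigID (mem C)) /= -[X in X <= _]addn0 leq_add //.
  under [X in _ <= X]eq_bigl do rewrite andbC.
  by apply: leq_sum => i _; apply: m_min.
have sum_le : \sum_(i in C) m i <= N.
  by apply: leq_trans (sum_ge i1 x0 sx0); rewrite (bigD1 i1) //= leq_add2r m_min.
have top_up (w : I -> nat) : \sum_(i in C) w i <= N ->
    \sum_i ((if i \in C then w i else 0) + (if i == i1 then N - \sum_(i in C) w i else 0)) = N.
  by move=> wN; rewrite big_split /= -!big_mkcond big_pred1_eq subnKC.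
have sum_gt : N < \sum_(i in C) m i + #|C|.
  rewrite ltnNge -sum1_card -big_split /=; apply/negP => le_N.
  have [y yE] := grid_simplex_ex (top_up _ le_N).
  have [i Ci] := dom_s y; have [x sx mx] := m_val i => /(_ x sx)/grid_rank_le.
  by rewrite -yE Ci -mx addn1 addSn; lia.
exists (fun i => (if i \in C then m i else 0) + (if i == i1 then N - \sum_(i in C) m i else 0)).
  exact: top_up.
move=> i z_gt0; have : i \in C.
  by apply: contraTT z_gt0 => Ci /=; rewrite (negPf Ci); case: eqP Ci => // ->; rewrite Ci1.
case/imsetP=> x sx ->; exists (fun j => val x j : nat) => //; split=> // j.
have cardC : #|C| <= #|I| by apply: max_card.
(* Both [val x j] and [z j] exceed [m j] (replaced by 0 for [j] outside [C]) by less than [#|C|]. *)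
have [mj sum_j] := (m_min j x sx, sum_ge j x sx).
have sumC : \sum_(i in C) m i =
    (if j \in C then m j else 0) + \sum_(i in C | i != j) m i.
  case: ifP => Cj; first by rewrite (bigD1 j).
  by apply: eq_bigl => k; case: eqP => [->|]; rewrite ?andbT ?Cj.
rewrite sumC in sum_le sum_gt *; move: mj sum_j sum_le sum_gt.
by move: (val x j : nat) => xj; case: ifP => Cj; case: eqP => [ji1|_]; lia.
Qed.

End Grid.

(** * An open KKM principle *)

From HB Require Import structures.
From mathcomp Require Import all_boot all_order all_algebra.
From mathcomp Require Import all_classical all_reals all_analysis.
From mathcomp Require Import ring lra.

Import Order.TTheory GRing.Theory Num.Theory.
Import numFieldNormedType.Exports.

Local Open Scope classical_set_scope.
Local Open Scope ring_scope.

Lemma compact_finite_subcover (T : topologicalType) (I : eqType) (A : set T)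
    (D : set I) (B : I -> set T) :
    compact A -> (forall i, D i -> open (B i)) -> A `<=` \bigcup_(i in D) B i ->
  exists (n : nat) (y : 'I_n -> I), (forall j, D (y j)) /\
    A `<=` \bigcup_(j in [set: 'I_n]) B (y j).
Proof.
move=> /compact_near_coveringP covA openB AB.
(* Finite lists from [D], directed by inclusion: covering [A] has to hold eventually along this
   filter. *)
pose F : set_system (seq I) := [set P | exists2 s0 : seq I,
  (forall i, i \in s0 -> D i) &
  forall s : seq I, {subset s0 <= s} -> (forall i, i \in s -> D i) -> P s].
have FF : Filter F.
  split; first by exists [::].
  - move=> P Q [s Ds sP] [s' Ds' s'Q]; exists (s ++ s').
      by move=> i; rewrite mem_cat => /orP[/Ds|/Ds'].
    move=> r sub Dr; split; first by apply: sP => // i si; apply: sub; rewrite mem_cat si.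
    by apply: s'Q => // i si; apply: sub; rewrite mem_cat si orbT.
  - by move=> P Q PQ [s Ds sP]; exists s => // r sr Dr; apply/PQ/sP.
have [s Ds sA] : F (fun s => A `<=` [set x | exists2 i, i \in s & B i x]).
  apply: (covA _ F (fun s x => exists2 i, i \in s & B i x)) => x /AB[i Di Bix].
  exists (B i, [set s : seq I | i \in s]) => /=.
    split; first exact: open_nbhs_nbhs (conj (openB i Di) Bix).
    exists [:: i] => [j|s sub _]; first by rewrite inE => /eqP->.
    by apply: sub; rewrite mem_head.
  by case=> x' s /= [Bix' si]; exists i.
exists (size s), (tnth (in_tuple s)); split=> [j|x Ax]; first exact/Ds/mem_tnth.
have [i si Bix] := sA s (fun _ => id) Ds x Ax.
by have /tnthP[j ij] : i \in in_tuple s by []; exists j; rewrite -?ij.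
Qed.

(** Induction on partial sums, normalised by their total weight once it is positive. Membership in
    [A] is asked only at positive weights, so that supports can be tracked later. *)
Lemma convex_comb_in (R : realFieldType) (V : lmodType R) (A : set V) :
    (forall x y t, A x -> A y -> 0 <= t <= 1 -> A (x + t *: (y - x))) ->
  forall (n : nat) (v : 'I_n -> V) (l : 'I_n -> R),
    (forall i, 0 <= l i) -> \sum_i l i = 1 -> (forall i, 0 < l i -> A (v i)) ->
  A (\sum_i l i *: v i).
Proof.
move=> convA n v l l_ge0 suml vA.
suff [[_]|[_]] : (\sum_i l i *: v i = 0 /\ \sum_i l i = 0) \/
    (0 < \sum_i l i /\ A ((\sum_i l i)^-1 *: \sum_i l i *: v i)).
- by rewrite suml => /eqP; rewrite oner_eq0.
- by rewrite suml invr1 scale1r.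
rewrite unlock; elim: (index_enum _) => [|a r IHr] /=; first by left.
set s := reducebig 0 r _ in IHr *; set t := reducebig 0 r _ in IHr *.
have [la0|la_neq0] := eqVneq (l a) 0; first by rewrite la0 scale0r !add0r.
have la_gt0 : 0 < l a by rewrite lt_def la_neq0 l_ge0.
right; case: IHr => [[-> ->]|[t_gt0 At]].
  by rewrite !addr0 scalerA mulVf // scale1r; split=> //; apply: vA.
have lat_gt0 : 0 < l a + t by rewrite addr_gt0.
split=> //.
have -> : (l a + t)^-1 *: (l a *: v a + s) =
    v a + (t / (l a + t)) *: (t^-1 *: s - v a).
  rewrite scalerDr scalerBr !scalerA [X in _ = _ + X]addrC addrA; congr (_ + _); last first.
    by congr (_ *: _); field; rewrite !gt_eqF.
  rewrite -[X in X - _]scale1r -scalerBl; congr (_ *: _).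
  by field; rewrite gt_eqF.
apply: convA => //; first exact: vA.
by rewrite ler_pdivrMr // mul1r lerDr (ltW la_gt0) divr_ge0 // ltW.
Qed.

Section TvsCombinations.
Variables (R : realType) (X : tvsType R).

Lemma lin_comb_continuous (n : nat) (y : 'I_n -> X) :
  continuous (fun p : X * 'rV[R]_n => p.1 + \sum_i p.2 ord0 i *: y i).
Proof.
move=> p; apply: continuous2_cvg; [exact: (add_continuous (_, _))|exact: cvg_fst|].
apply: cvg_big => [|i _]; first exact: add_continuous.
apply: continuous2_cvg; [exact: (scale_continuous (_, _))| |exact: cvg_cst].
have coordP : (fun q : X * 'rV[R]_n => q.2 ord0 i) @ nbhs p --> p.2 ord0 i.
  by apply: (@cvg_comp _ _ _ snd (fun M : 'rV[R]_n => M ord0 i) _ (nbhs p.2));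
    [exact: cvg_snd|exact: coord_continuous].
exact: coordP.
Qed.

(** In place of a metric on [X], smallness is measured by coefficients along the [y j]; joint
    continuity at [(x, 0)] gives a local [d], and compactness a uniform one. *)
Lemma lebesgue_number (n : nat) (y : 'I_n -> X) (A : set X) (B : 'I_n -> set X) :
    compact A -> (forall i, open (B i)) -> A `<=` \bigcup_i B i ->
  exists2 d : R, 0 < d & forall x, A x -> exists i, forall w : 'I_n -> R,
    (forall j, `|w j| < d) -> B i (x + \sum_j w j *: y j).
Proof.
move=> /compact_near_coveringP covA openB AB.
suff [d [d_gt0 dA]] : exists d : R, 0 < d /\ A `<=` [set x | exists i,
    forall w : 'I_n -> R, (forall j, `|w j| < d) -> B i (x + \sum_j w j *: y j)].
  by exists d.
apply: (@filter_ex _ (0 : R)^'+).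
near=> d; split; first by near: d; exact: nbhs_right_gt.
near: d; apply: (covA _ (0^'+) (fun d x => exists i, forall w : 'I_n -> R,
  (forall j, `|w j| < d) -> B i (x + \sum_j w j *: y j))) => x /AB[i _ Bix].
have : nbhs (x + \sum_j (0 : 'rV[R]_n) ord0 j *: y j) (B i).
  rewrite big1 ?addr0; first exact: open_nbhs_nbhs (conj (openB i) Bix).
  by move=> j _; rewrite mxE scale0r.
move/(@lin_comb_continuous n y (x, 0)) => -[[/= U W] [Ux W0] UW].
have /nbhs_ballP[e /= e_gt0 eW] := W0.
exists (U, [set d | d < e]) => /=; first by split=> //; exact: nbhs_right_lt.
case=> x' d /= [Ux' de]; exists i => w wd.
have := UW (x', \row_j w j) => /=.
under eq_bigr do rewrite mxE; apply; split=> //; apply: eW.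
by split=> // k j; rewrite !mxE /ball /= sub0r normrN (lt_trans (wd j)).
Unshelve. all: by end_near. Qed.

Lemma convex_comb_convex_set (A : set X) (n : nat) (y : 'I_n -> X) (l : 'I_n -> R) :
    convex_set A -> (forall i, 0 <= l i) -> \sum_i l i = 1 -> (forall i, A (y i)) ->
  A (\sum_i l i *: y i).
Proof.
move=> convA l_ge0 suml yA; apply: convex_comb_in => // x z t Ax Az t01.
have t_itv : Itv.spec (@Itv.num_sem R) (Itv.Real `[0%Z, 1%Z]) t.
  by rewrite /= /Itv.num_sem /= in_itv /= num_real t01.
have /set_mem := convA z x (Itv.mk t_itv) (mem_set Az) (mem_set Ax).
rewrite /conv /= scalerBl scale1r scalerBr addrCA.
by rewrite addrC -addrA [X in _ + X]addrC.
Qed.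

(** Each grid point is coloured by a set [B i] that contains all its small perturbations. A point
    [z] close to grid points of every colour in its support then lies in all the corresponding
    [B i]. *)
Lemma open_kkm (A : set X) (n : nat) (y : 'I_n -> X) (B : 'I_n -> set X) :
    A !=set0 -> compact A -> convex_set A -> (forall i, A (y i)) ->
    (forall i, open (B i)) -> A `<=` \bigcup_i B i ->
  exists l : 'I_n -> R, [/\ forall i, 0 <= l i, \sum_i l i = 1 &
    forall i, 0 < l i -> B i (\sum_j l j *: y j)].
Proof.
move=> [a0 Aa0] compA convA yA openB AB.
have [i0 _ _] := AB _ Aa0.
have [d d_gt0 dA] := lebesgue_number y compA openB AB.
(* [colored_grid] errs by at most [n] in each coordinate, hence by [n / N < d] after rescaling. *)
pose N := (Num.truncn (n%:R / d)).+1.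
have N_gt0 : 0 < N%:R :> R by rewrite ltr0n.
have nN : n%:R / N%:R < d.
  by rewrite ltr_pdivrMr // -ltr_pdivrMl // mulrC truncnS_gt.
pose wt (x : 'I_n -> nat) i : R := (x i)%:R / N%:R.
have wt_ge0 x i : 0 <= wt x i by rewrite divr_ge0.
have wt_sum x : (\sum_i x i = N)%N -> \sum_i wt x i = 1.
  by move=> xN; rewrite -mulr_suml -natr_sum xN divff // gt_eqF.
have ball_ex (x : 'I_n -> nat) : exists i, (\sum_j x j = N)%N ->
    forall w : 'I_n -> R, (forall j, `|w j| < d) ->
    B i (\sum_j wt x j *: y j + \sum_j w j *: y j).
  have [xN|] := pselect (\sum_j x j = N)%N; last by exists i0.
  by have [i] := dA _ (convex_comb_convex_set convA (wt_ge0 x) (wt_sum x xN) yA); exists i.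
have [c cP] := choice ball_ex.
have [z zN zP] := colored_grid N c i0.
exists (wt z); split=> // [|i]; first exact: wt_sum.
rewrite /wt pmulr_lgt0 ?invr_gt0 // ltr0n => /zP[x xN [<- zx]].
have := cP x xN (fun j => wt z j - wt x j); rewrite -big_split /=.
under eq_bigr do rewrite -scalerDl addrC subrK; apply=> j.
apply: le_lt_trans nN; rewrite /wt -mulrBl normrM normfV (ger0_norm (ltW N_gt0)).
rewrite ler_pM2r ?invr_gt0 //; have [] := zx j; rewrite card_ord.
rewrite -!(ler_nat R) !natrD => zxj xzj; rewrite ler_norml; apply/andP; split; lra.
Qed.

(** The points approximable in this way include each [y i] with [l i] positive, and density on
    segments with endpoints in [D] makes them a convex set. [D] itself need not be convex. *)
Lemma self_segment_dense_hull (K D : set X) (n : nat) (y : 'I_n -> X) (l : 'I_n -> R)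
    (W : set X) :
    self_segment_dense D K -> (forall i, D (y i)) ->
    (forall i, 0 <= l i) -> \sum_i l i = 1 -> nbhs (\sum_i l i *: y i) W ->
  exists m : 'I_n -> R, [/\ forall i, 0 <= m i, \sum_i m i = 1,
    forall i, 0 < m i -> 0 < l i & (D `&` W) (\sum_i m i *: y i)].
Proof.
move=> [_ segD] yD l_ge0 suml; move: W.
pose A : set X := [set x | forall W, nbhs x W -> exists m : 'I_n -> R,
  [/\ forall i, 0 <= m i, \sum_i m i = 1,
      forall i, 0 < m i -> 0 < l i & (D `&` W) (\sum_i m i *: y i)]].
suff : A (\sum_i l i *: y i) by [].
apply: convex_comb_in => // [x z t Ax Az /andP[t_ge0 t_le1] W xzW|i li_gt0 W yW]; last first.
  exists (fun j => (j == i)%:R).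
  have pE (V : lmodType R) (v : 'I_n -> V) : \sum_j (j == i)%:R *: v j = v i.
    rewrite (bigD1 i) //= eqxx scale1r big1 ?addr0 // => j /negPf->.
    by rewrite scale0r.
  split=> //.
  - by rewrite -[RHS](pE R^o (fun=> 1)); apply: eq_bigr => j _; rewrite /= /GRing.scale /= mulr1.
  - by move=> j; case: eqP => [->//|_]; rewrite ltxx.
  - by rewrite pE; split; [exact: yD|exact: nbhs_singleton].
have q_cont : continuous (fun p : X * X => p.1 + t *: (p.2 - p.1)).
  move=> p; apply: continuous2_cvg; [exact: (add_continuous (_, _))|exact: cvg_fst|].
  apply: continuous2_cvg; [exact: (scale_continuous (_, _))|exact: cvg_cst|].
  apply: continuous2_cvg; [exact: (add_continuous (_, _))|exact: cvg_snd|].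
  by apply: (@cvg_comp _ _ _ fst -%R _ (nbhs p.1));
    [exact: cvg_fst|exact: (@opp_continuous X)].
(* The interior is pulled back so that [W] is still a neighbourhood of the perturbed point
   [u + t *: (v - u)]. *)
have /(q_cont (x, z))[[/= U V] [Ux Vz] UV] := nbhs_interior xzW.
have [m [m_ge0 summ ml [Dm Um]]] := Ax U Ux.
have [m' [m'_ge0 summ' m'l [Dm' Vm']]] := Az V Vz.
set u := \sum_i m i *: y i in Dm Um; set v := \sum_i m' i *: y i in Dm' Vm'.
have uvW : nbhs (u + t *: (v - u)) W by apply: (UV (u, v)).
have uv_seg : segment u v (u + t *: (v - u)).
  by exists t => //; rewrite /= in_itv /= t_ge0.
have [w [[[s]]]] := segD u v Dm Dm' _ uv_seg W uvW.
rewrite /= in_itv /= => /andP[s_ge0 s_le1] <- Dw Ww.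
exists (fun i => m i + s * (m' i - m i)); split.
- move=> i; rewrite (_ : _ + _ = (1 - s) * m i + s * m' i); last by ring.
  by rewrite addr_ge0 // mulr_ge0 // subr_ge0.
- by rewrite big_split /= -mulr_sumr sumrB summ summ' subrr mulr0 addr0.
- move=> i; have [/m'l//|m'0] := ltP 0 (m' i).
  have [/ml//|m0] := ltP 0 (m i).
  have -> : m i = 0 by apply: le_anti; rewrite m0 m_ge0.
  have -> : m' i = 0 by apply: le_anti; rewrite m'0 m'_ge0.
  by rewrite subrr mulr0 addr0 ltxx.
- suff -> : \sum_i (m i + s * (m' i - m i)) *: y i = u + s *: (v - u) by [].
  rewrite /u /v -sumrB scaler_sumr -big_split; apply: eq_bigr => i _.
  by rewrite /= scalerDl -scalerA scalerBl.
Qed.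

End TvsCombinations.

(** * Pointed convex cones and strong upper semicontinuity *)

Section Cones.
Variables (R : realType) (Z : lmodType R) (C : set Z).
Hypotheses (convC : convex_cone C) (pointC : pointed_cone C).

Lemma convex_coneD a b : C a -> C b -> C (a + b).
Proof. by move=> Ca Cb; case: convC => _ <-; exists a => //; exists b. Qed.

Lemma pointed_coneD a b : (C `\ 0) a -> C b -> (C `\ 0) (a + b).
Proof.
move=> [Ca a0] Cb; split; first exact: convex_coneD.
move=> ab0; apply: a0; rewrite -pointC; split=> //.
by exists b => //; apply/eqP; rewrite eq_sym -addr_eq0; apply/eqP.
Qed.

Lemma pointed_coneZ a t : (C `\ 0) a -> 0 < t -> (C `\ 0) (t *: a).
Proof.
move=> [Ca a0] t_gt0; split; first by apply: convC.1; rewrite ?ltW.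
by move/eqP; rewrite scaler_eq0 gt_eqF //= => /eqP.
Qed.

Lemma pointed_cone_comb (n : nat) (m : 'I_n -> R) (v : 'I_n -> Z) :
    (forall i, 0 <= m i) -> \sum_i m i = 1 -> (forall i, 0 < m i -> (C `\ 0) (v i)) ->
  (C `\ 0) (\sum_i m i *: v i).
Proof.
move=> m_ge0 summ vC; apply: convex_comb_in => // x y t Cx Cy /andP[].
rewrite le_eqVlt => /orP[/eqP<- _|t_gt0]; first by rewrite scale0r addr0.
rewrite le_eqVlt => /orP[/eqP->|t_lt1]; first by rewrite scale1r addrC subrK.
rewrite (_ : _ + _ = (1 - t) *: x + t *: y).
  apply: pointed_coneD; first by apply: pointed_coneZ; rewrite ?subr_gt0.
  by apply: (pointed_coneZ Cy t_gt0).1.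
by rewrite scalerBl scale1r scalerBr addrAC addrA.
Qed.

Lemma neg_coneP z : ([set - c | c in C] `\ 0) z <-> (C `\ 0) (- z).
Proof.
split=> [[[c Cc <-]]|[Cz z0]].
  by move=> c0; rewrite opprK; split=> // c0'; apply: c0; rewrite c0' oppr0.
split; first by exists (- z); rewrite ?opprK.
by move=> z0'; apply: z0; rewrite z0' oppr0.
Qed.

(** The choice [k = - g x] cancels [g x] and leaves [g u] in the negative of [C] without 0. *)
Lemma strongly_usc_at_neg_cone (X : tvsType R) (K : set X) (g : X -> Z) (x : X) :
    strongly_usc_at C K g x -> (C `\ 0) (- g x) ->
  \forall u \near x, K u -> (C `\ 0) (- g u).
Proof.
move=> usc Cgx; apply: filterS (usc _ Cgx) => u + Ku => /(_ Ku)[c Cc].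
by rewrite subrr add0r => <-; rewrite opprK.
Qed.

End Cones.

Theorem theorem4p1 (R : realType) (X Z : tvsType R)
    (hausX : hausdorff_space X) (hausZ : hausdorff_space Z)
    (C : set Z) (convC : convex_cone C) (pointC : pointed_cone C)
    (K : set X) (K0 : K !=set0) (convK : convex_set K) (compK : compact K)
    (D : set X) (DK : D `<=` K) (denseD : self_segment_dense D K)
    (f : X -> X -> Z)
    (usc1 : forall y, D y -> strongly_usc_on C K K (fun x => f x y))
    (usc2 : forall x, K x -> strongly_usc_on C K (K `\` D) (fun y => f x y))
    (conv2 : forall x, D x -> C_convex_on C D (fun y => f x y))
    (diag : forall x, D x -> ~ ([set - c | c in C] `\ 0) (f x x)) :
  exists2 x0, K x0 & forall y, K y -> ~ ([set - c | c in C] `\ 0) (f x0 y).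
Proof.
suff [x0 Kx0 x0D] : exists2 x0, K x0 & forall y, D y -> ~ (C `\ 0) (- f x0 y).
  exists x0 => // y Ky /neg_coneP; have [Dy|nDy] := pselect (D y); first exact: x0D.
  move/(strongly_usc_at_neg_cone (usc2 _ Kx0 _ (conj Ky nDy))) => near_y.
  have [u [Du /(_ (DK _ Du))]] := denseD.1 y Ky _ near_y; exact: x0D.
apply: contrapT => noK.
have bad x : K x -> exists2 y, D y & (C `\ 0) (- f x y).
  move=> Kx; apply: contrapT => noD; apply: noK; exists x => // y Dy Cy.
  by apply: noD; exists y.
(* The premise [K u] turns relative openness in [K] into openness in [X]. *)
pose B y := [set u | K u -> (C `\ 0) (- f u y)]^°.
have BK : K `<=` \bigcup_(y in D) B y.
  by move=> x Kx; have [y Dy Cy] := bad x Kx; exists y => //;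
    apply: (strongly_usc_at_neg_cone (usc1 _ Dy _ Kx)).
have [n [y [yD yB]]] := compact_finite_subcover compK (fun y _ => @open_interior _ _) BK.
have [l [l_ge0 suml lB]] := open_kkm K0 compK convK (fun i => DK _ (yD i))
  (fun i => @open_interior _ _) yB.
have near_l : \forall u \near \sum_i l i *: y i,
    forall i, 0 < l i -> K u -> (C `\ 0) (- f u (y i)).
  apply: filter_forall => i; have [/lB|_] := ltP 0 (l i); last exact: filterE.
  by apply: filterS => u + _.
have [m [m_ge0 summ ml [Dd dl]]] :=
  self_segment_dense_hull denseD yD l_ge0 suml near_l.
set d := \sum_i m i *: y i in Dd dl.
apply: (diag _ Dd); apply/neg_coneP => //.
(* With [S] the sum of the [m i *: f d (y i)], write [- f d d = - S + (S - f d d)]: the first term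
   is in [C] and nonzero, the second is in [C] by convexity of [f d] on [D]. *)
rewrite -[- f d d](addKr (\sum_i m i *: f d (y i))) -sumrN.
under eq_bigr do rewrite -scalerN.
apply: pointed_coneD => //; last exact: conv2.
apply: pointed_cone_comb => // i mi_gt0; apply: dl; [exact: ml|exact: DK _ Dd].
Qed.
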